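(* Let $n$ be a positive integer. For arbitrary $K\in\mathcal{K}^n$ with $K=-K$, we have $\breve w_2(K)=\frac12$.
   Context: $\mathcal{K}^n$ denotes the class of $n$-dimensional convex bodies, i.e. compact convex subsets of $\mathbb{R}^n$ with nonempty interior. For $K\in\mathcal{K}^n$, $C(K)$ is the space of continuous real-valued functions on $K$ with norm $\|f\|_K=\max_{x\in K}|f(x)|$, and $\breve C(K)$ is the set of those $f\in C(K)$ that are convex on $K$, i.e. satisfy $f(x)+f(y)\ge 2f((x+y)/2)$ for all $x,y\in K$. $\mathcal{P}_{m,n}$ is the space of real algebraic polynomials of total degree $\le m$ in $n$ variables. For $f\in C(K)$, \[ E_m(f;K)=\inf_{P\in\mathcal{P}_{m,n}}\|f-P\|_K, \] and the $m$-th modulus of smoothness is \[ \omega_m(f;K)=\max_{x,x+h,\dots,x+mh\in K}|\Delta_h^m(f;x)|,\qquad \Delta_h^m(f;x)=\sum_{j=0}^m(-1)^j\binom mj f(x+jh), \] the maximum being over all $x,h\in\mathbb{R}^n$ with $x,x+h,\dots,x+mh\in K$. The Whitney constant for convex functions is \[ \breve w_m(K)=\sup\{E_{m-1}(f;K): f\in\breve C(K),\ \omega_m(f;K)\le 1\}. \] *)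

(* Defs.v *)
From mathcomp Require Import all_boot all_order all_algebra.
From mathcomp Require Import all_classical all_reals all_analysis.
From mathcomp Require mpoly.
Import -(notations) mpoly.

Set Implicit Arguments.
Unset Strict Implicit.
Unset Printing Implicit Defensive.

Import Order.TTheory GRing.Theory Num.Theory.
Import numFieldNormedType.Exports.

Local Open Scope classical_set_scope.
Local Open Scope ring_scope.

(* A function on K is represented by a function on the whole space; every
   notion below depends only on its values on K. Norms, moduli and constants
   take values in \bar R, so that no default value is ever involved; the usual
   maxima are written as suprema, attained when K is compact and f continuous
   on K. *)

Definition convex_body (R : realType) (n : nat) (K : set 'rV[R]_n) : Prop :=
  [/\ compact K, convex_set K & K° !=set0].

Definition continuous_convex_on (R : realType) (n : nat) (K : set 'rV[R]_n)
    (f : 'rV[R]_n -> R) : Prop :=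
  {within K, continuous f} /\
  forall x y, K x -> K y -> f x + f y >= 2 * f (2^-1 *: (x + y)).

Definition sup_norm_on (R : realType) (n : nat) (K : set 'rV[R]_n)
    (f : 'rV[R]_n -> R) : \bar R :=
  ereal_sup [set (`|f x|)%:E | x in K].

(* msize is the total degree plus one, and 0 for the zero polynomial. *)
Definition poly_deg_le (R : realType) (m n : nat) : set (mpoly n R) :=
  [set P | (msize P <= m.+1)%N].

Definition mpoly_fun (R : realType) (n : nat) (P : mpoly n R)
    (x : 'rV[R]_n) : R :=
  meval (fun i => x ord0 i) P.

Definition best_approx (R : realType) (m n : nat) (f : 'rV[R]_n -> R)
    (K : set 'rV[R]_n) : \bar R :=
  ereal_inf [set sup_norm_on K (fun x => f x - mpoly_fun P x)
            | P in @poly_deg_le R m n].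

Definition finite_diff (R : realType) (m n : nat) (h : 'rV[R]_n)
    (f : 'rV[R]_n -> R) (x : 'rV[R]_n) : R :=
  \sum_(j < m.+1) (-1) ^+ j * 'C(m, j)%:R * f (x + j%:R *: h).

Definition modulus_smoothness (R : realType) (m n : nat) (f : 'rV[R]_n -> R)
    (K : set 'rV[R]_n) : \bar R :=
  ereal_sup [set (`|finite_diff m xh.2 f xh.1|)%:E
            | xh in [set xh : 'rV[R]_n * 'rV[R]_n |
                     forall j, (j <= m)%N -> K (xh.1 + j%:R *: xh.2)]].

Definition whitney_convex (R : realType) (m n : nat) (K : set 'rV[R]_n) :
    \bar R :=
  ereal_sup [set best_approx m.-1 f K
            | f in [set f : 'rV[R]_n -> R | continuous_convex_on K f /\
                    (modulus_smoothness m f K <= 1)%E]].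

(* Main.v *)
Require Import Defs.
From mathcomp Require Import all_boot all_order all_algebra.
From mathcomp Require Import all_classical all_reals all_analysis.
From mathcomp Require mpoly.
From mathcomp Require Import ring lra.
Import -(notations) mpoly.
Import Order.TTheory GRing.Theory Num.Theory.
Import numFieldNormedType.Exports.
Local Open Scope classical_set_scope.
Local Open Scope ring_scope.

(** Upper bound. By symmetry 0 is an interior point of K, so a convex f on K has
    a subgradient there: a linear form l with f 0 + l <= f on K
    ([subgradient_exists]). Put g := f - f 0 - l. Then g >= 0 = g 0, and the
    second difference of g centred at 0 with step x is g (- x) + g x, which
    equals that of f and hence is at most 1. Since g (- x) >= 0, this gives
    0 <= g <= 1 on K, so the affine function f 0 + l + 1/2 is within 1/2 of f.

    Lower bound. Let a coordinate attain its maximum M over K at v, and for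
    small e > 0 let f rise from 0 to 1 linearly in that coordinate on the thin
    cap [x_i >= (1 - e) M] and vanish elsewhere on K. This f is convex and is a
    monotone function of one coordinate with values in [0, 1], so its second
    differences lie in [0, 1]. On the three collinear points - v, (1 - e) v, v
    it takes the values 0, 0, 1, and an affine function that is nearly 1 at v
    and nearly 0 at - v is nearly 1 - e / 2 at (1 - e) v; so no affine function
    is closer than 1/2 - e / 4. In the limit e -> 0 the bound 1/2 appears, as
    a supremum that this family does not attain.

    The subgradient is produced one coordinate at a time, by the Hahn-Banach
    extension step ([affine_minorant_extend]) applied to f on K itself. This
    uses the full convexity inequality, which follows from its midpoint case
    because f is bounded on the compact set K
    ([midpoint_convex_bounded_convex]). *)

(** * Convex sets and midpoint convexity *)

Lemma convex_set_comb (R : realType) (E : lmodType R) (K : set E)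
    (hK : convex_set K) (x y : E) (t : R) :
  K x -> K y -> 0 <= t <= 1 -> K (t *: x + (1 - t) *: y).
Proof.
move=> Kx Ky /andP[t0 t1].
by have /set_mem := hK x y (Itv01 t0 t1) (mem_set Kx) (mem_set Ky).
Qed.

(** If z is interior to K, then z + t *: e is in K for small t > 0, and its
    midpoint with - z is (t / 2) *: e. *)
Lemma symmetric_convex_small (R : realType) (E : normedModType R) (K : set E)
    (hK : convex_set K) (hint : K° !=set0) (hsym : K = -%R @` K) (e : E) :
  exists2 d : R, 0 < d & K (d *: e).
Proof.
have [z Kz] := hint.
have cz : (fun t : R => z + t *: e) t @[t --> 0] --> z.
  rewrite -[X in _ --> X](addr0 z) -(scale0r e).
  by apply: cvgD; [exact: cvg_cst | exact: scalel_continuous].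
have Kt : \forall t \near (0 : R)^'+, K (z + t *: e).
  exact: (cvg_at_right_filter cz) Kz.
have [t [Kzt t0]] := filter_ex (filterI Kt (nbhs_right_gt 0)).
exists (2^-1 * t); first by rewrite mulr_gt0.
have KNz : K (- z) by rewrite hsym; exists z => //; exact: interior_subset.
have := convex_set_comb R E K hK _ _ 2^-1 Kzt KNz _.
have -> : 2^-1 *: (z + t *: e) + (1 - 2^-1) *: - z = (2^-1 * t) *: e.
  have -> : 1 - 2^-1 = 2^-1 :> R by field.
  by rewrite -scalerDr addrAC subrr add0r scalerA.
by apply; lra.
Qed.

(** Along the segment, the gap h between f and its chord vanishes at both ends.
    Every s in [0, 1/2] is the midpoint of 0 and 2 s, so h s <= h (2 s) / 2, and
    likewise from the other end on [1/2, 1]. Any upper bound of h on [0, 1] can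
    thus be halved repeatedly, which forces h <= 0. *)
Lemma midpoint_convex_bounded_convex (R : realType) (E : lmodType R) (K : set E)
    (hK : convex_set K) (f : E -> R) (B : R)
    (hmid : forall x y, K x -> K y -> 2 * f (2^-1 *: (x + y)) <= f x + f y)
    (hB : forall x, K x -> f x <= B) (x y : E) (t : R) :
  K x -> K y -> 0 <= t <= 1 ->
  f (t *: x + (1 - t) *: y) <= t * f x + (1 - t) * f y.
Proof.
move=> Kx Ky.
pose p s := s *: x + (1 - s) *: y.
pose h s := f (p s) - (s * f x + (1 - s) * f y).
have Kp s : 0 <= s <= 1 -> K (p s) by exact: convex_set_comb.
have p1 : p 1 = x by rewrite /p subrr scale0r scale1r addr0.
have p0 : p 0 = y by rewrite /p subr0 scale0r scale1r add0r.
have pM r s : 2^-1 *: (p r + p s) = p (2^-1 * (r + s)).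
  rewrite /p addrACA -!scalerDl scalerDr !scalerA; congr (_ + _ *: _).
  by field.
have hM r s : 0 <= r <= 1 -> 0 <= s <= 1 ->
    2 * h (2^-1 * (r + s)) <= h r + h s.
  move=> r01 s01; have := hmid _ _ (Kp _ r01) (Kp _ s01).
  rewrite pM /h; lra.
have h0 : h 0 = 0 by rewrite /h p0; ring.
have h1 : h 1 = 0 by rewrite /h p1; ring.
pose C := `|B| + `|f x| + `|f y|.
have hC s : 0 <= s <= 1 -> h s <= C.
  move=> s01; have hN (a c : R) : 0 <= a <= 1 -> - (a * c) <= `|c|.
    move=> /andP[a0 a1]; rewrite (le_trans (ler_norm _)) // normrN normrM.
    by rewrite ger0_norm // ler_piMl.
  have := hB _ (Kp _ s01); have := ler_norm B; rewrite /h /C.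
  have := hN s (f x) s01; have : 0 <= 1 - s <= 1 by lra.
  by move=> /(hN _ (f y)); lra.
have C0 : 0 <= C by rewrite !addr_ge0.
have hhalf k : forall s, 0 <= s <= 1 -> h s <= C / 2 ^+ k.
  elim: k => [|k IH] s s01; first by rewrite expr0 divr1 hC.
  rewrite exprS invfM mulrCA.
  have [s2|s2] := leP s 2^-1.
    have s01' : 0 <= 2 * s <= 1 by move: s01 s2; lra.
    have := hM 0 (2 * s) ltac:(lra) s01'; have := IH _ s01'.
    rewrite h0 (_ : 2^-1 * (0 + 2 * s) = s); last by field.
    by lra.
  have s01' : 0 <= 2 * s - 1 <= 1 by move: s01 s2; lra.
  have := hM 1 (2 * s - 1) ltac:(lra) s01'; have := IH _ s01'.
  rewrite h1 (_ : 2^-1 * (1 + (2 * s - 1)) = s); last by field.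
  by lra.
move=> t01; rewrite -subr_le0; apply/ler_addgt0Pl => e e0; rewrite addr0.
have [k Hk] : exists k : nat, C / e < k%:R.
  by exists (Num.bound (C / e)); apply: archi_boundP; rewrite divr_ge0 // ltW.
apply: le_trans (hhalf k t t01) _.
rewrite ler_pdivrMr ?exprn_gt0 // mulrC -ler_pdivrMr //.
by apply: (le_trans (ltW Hk)); rewrite -natrX ler_nat ltnW // ltn_expl.
Qed.

(** * Subgradients *)

(** The slope s along e has to dominate the quotients
    (c + l v - f (v - a *: e)) / a and be dominated by the quotients
    (f (w + b *: e) - c - l w) / b. The first are below the second because the
    convex combination of v - a *: e and w + b *: e with weights proportional to
    b and a cancels e and lies in W, where the minorant is known. [hpos] and
    [hneg] ensure that both families are nonempty, so the supremum of the first
    is a suitable slope. *)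
Lemma affine_minorant_extend (R : realType) (E : lmodType R) (K W : set E)
    (hK : convex_set K) (hW : forall (a b : R) v w, W v -> W w -> W (a *: v + b *: w))
    (f : E -> R) (c : R) (l : E -> R) (e : E)
    (hf : forall x y t, K x -> K y -> 0 <= t <= 1 ->
       f (t *: x + (1 - t) *: y) <= t * f x + (1 - t) * f y)
    (hl : forall (a b : R) v w, l (a *: v + b *: w) = a * l v + b * l w)
    (hmin : forall v, W v -> K v -> c + l v <= f v)
    (hpos : exists v t, [/\ W v, 0 < t & K (v + t *: e)])
    (hneg : exists v t, [/\ W v, 0 < t & K (v - t *: e)]) :
  exists s : R, forall v t, W v -> K (v + t *: e) -> c + l v + t * s <= f (v + t *: e).
Proof.
have sep v w a b : W v -> W w -> 0 < a -> 0 < b ->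
    K (v - a *: e) -> K (w + b *: e) ->
    (c + l v - f (v - a *: e)) / a <= (f (w + b *: e) - c - l w) / b.
  move=> Wv Ww a0 b0 Kv Kw.
  have ab0 : 0 < a + b by rewrite addr_gt0.
  (* this weight makes t *: (v - a *: e) + (1 - t) *: (w + b *: e) free of e *)
  pose t := b / (a + b).
  have t1E : 1 - t = a / (a + b) by rewrite /t; field; rewrite gt_eqF.
  have t01 : 0 <= t <= 1.
    by rewrite -[t <= 1]subr_ge0 t1E !divr_ge0 // ltW.
  have pE : t *: (v - a *: e) + (1 - t) *: (w + b *: e) = t *: v + (1 - t) *: w.
    rewrite !scalerDr scalerN !scalerA addrACA t1E /t.
    rewrite (_ : a / (a + b) * b = b / (a + b) * a); last by ring.
    by rewrite addNr addr0.
  have := hf _ _ _ Kv Kw t01; rewrite pE => hf1.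
  have hm : c + l (t *: v + (1 - t) *: w) <= f (t *: v + (1 - t) *: w).
    by apply: hmin; [exact: hW | rewrite -pE; exact: convex_set_comb].
  rewrite hl in hm.
  rewrite ler_pdivrMr // mulrAC ler_pdivlMr //.
  have := le_trans hm hf1; rewrite t1E /t.
  rewrite -(ler_pM2r ab0).
  have -> : (c + (b / (a + b) * l v + a / (a + b) * l w)) * (a + b) =
            c * (a + b) + b * l v + a * l w by field; rewrite gt_eqF.
  have -> : (b / (a + b) * f (v - a *: e) + a / (a + b) * f (w + b *: e)) * (a + b)
     = b * f (v - a *: e) + a * f (w + b *: e) by field; rewrite gt_eqF.
  lra.
pose A := [set r | exists v a, [/\ W v, 0 < a, K (v - a *: e) &
                       r = (c + l v - f (v - a *: e)) / a]].
have A0 : A !=set0.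
  by have [v [a [Wv a0 Kv]]] := hneg; exists ((c + l v - f (v - a *: e)) / a), v, a.
have Aub w b : W w -> 0 < b -> K (w + b *: e) ->
    ubound A ((f (w + b *: e) - c - l w) / b).
  by move=> Ww b0 Kw _ [v [a [Wv a0 Kv ->]]]; exact: sep.
have Asup : has_sup A.
  by split => //; have [w [b [Ww b0 Kw]]] := hpos; eexists; exact: Aub Ww b0 Kw.
exists (sup A) => v t Wv.
have [t0|t0|->] := ltgtP t 0; last first.
- by rewrite scale0r mul0r !addr0; exact: hmin.
- move=> Kv; have := ge_sup A0 (Aub _ _ Wv t0 Kv).
  by rewrite ler_pdivlMr //; lra.
- move=> Kv; have Kv' : K (v - (- t) *: e) by rewrite scaleNr opprK.
  have : (c + l v - f (v - (- t) *: e)) / (- t) <= sup A.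
    by apply: ub_le_sup; [exact: Asup.2 | exists v, (- t); split => //; rewrite oppr_gt0].
  by rewrite ler_pdivrMr ?oppr_gt0 // scaleNr opprK; lra.
Qed.

(** Induction on k, with the minorant required on the vectors supported on the
    first k coordinates. The hypothesis [hsmall] says that 0 is an algebraically
    interior point of K, so that each new direction is entered both ways. *)
Lemma subgradient_exists (R : realType) (n : nat) (K : set 'rV[R]_n)
    (hK : convex_set K) (f : 'rV[R]_n -> R)
    (hf : forall x y t, K x -> K y -> 0 <= t <= 1 ->
       f (t *: x + (1 - t) *: y) <= t * f x + (1 - t) * f y)
    (hsmall : forall e, exists2 d : R, 0 < d & K (d *: e)) :
  exists c : 'cV[R]_n, forall x, K x -> f 0 + (x *m c) ord0 ord0 <= f x.
Proof.
pose l (c : 'cV[R]_n) (x : 'rV[R]_n) := (x *m c) ord0 ord0.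
have lE c (a b : R) v w : l c (a *: v + b *: w) = a * l c v + b * l c w.
  by rewrite /l mulmxDl -!scalemxAl !mxE.
pose W k := [set x : 'rV[R]_n | forall i : 'I_n, (k <= i)%N -> x ord0 i = 0].
have W0 k : W k 0 by move=> i _; rewrite mxE.
suff H k : (k <= n)%N -> exists c, forall x, W k x -> K x -> f 0 + l c x <= f x.
  have [c hc] := H n (leqnn n); exists c => x Kx; apply: hc => // i.
  by rewrite leqNgt ltn_ord.
elim: k => [_|k IH kn].
  exists 0 => x Wx _; have -> : x = 0 by apply/rowP => i; rewrite Wx // mxE.
  by rewrite /l mulmx0 mxE addr0.
have [c hc] := IH (ltnW kn).
pose i0 := Ordinal kn; pose e : 'rV[R]_n := delta_mx ord0 i0.
have hW (a b : R) v w : W k v -> W k w -> W k (a *: v + b *: w).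
  by move=> Wv Ww i ki; rewrite !mxE Wv // Ww // !mulr0 addr0.
have [] := affine_minorant_extend R _ K (W k) hK hW f (f 0) (l c) e hf (lE c) hc.
- by have [d d0 Kd] := hsmall e; exists 0, d; rewrite add0r.
- have [d d0 Kd] := hsmall (- e).
  by exists 0, d; rewrite add0r -scalerN.
(* The correction of c leaves l unchanged on W k and gives it the value s at e. *)
move=> s hs; exists (c + (s - l c e) *: delta_mx i0 ord0) => x Wx Kx.
pose v := x - x ord0 i0 *: e.
have xE : x = v + x ord0 i0 *: e by rewrite subrK.
have Wv : W k v.
  move=> i; rewrite leq_eqVlt !mxE eqxx /= => /orP[/eqP ki|ki].
    have -> : i = i0 by apply: val_inj.
    by rewrite eqxx mulr1 subrr.
  by rewrite Wx // (_ : (i == i0) = false) ?mulr0 ?subr0 //; apply: gtn_eqF.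
have := hs v (x ord0 i0) Wv; rewrite -xE => /(_ Kx).
have -> : l (c + (s - l c e) *: delta_mx i0 ord0) x =
    l c x + (s - l c e) * x ord0 i0.
  by rewrite /l mulmxDr -scalemxAr -colE !mxE.
have -> : l c v = l c x - x ord0 i0 * l c e.
  by have := lE c 1 (- x ord0 i0) x e; rewrite scale1r scaleNr mul1r mulNr.
by lra.
Qed.

(** * Polynomials of degree at most one *)

Lemma mpoly_fun_affine (R : realType) (n : nat) (P : mpoly n R)
    (hP : (msize P <= 2)%N) (x y : 'rV[R]_n) (t : R) :
  mpoly_fun P (t *: x + (1 - t) *: y) =
  t * mpoly_fun P x + (1 - t) * mpoly_fun P y.
Proof.
rewrite /mpoly_fun !mevalE !mulr_sumr -big_split /=.
apply: eq_big_seq => m mP.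
rewrite -[X in _ = X + _]mulrCA -[X in _ = _ + X]mulrCA -mulrDr; congr (_ * _).
have : (mdeg m <= 1)%N by rewrite -ltnS (leq_trans (msize_mdeg_lt mP)).
case: (posnP (mdeg m)) => [/eqP|m0 m1].
  rewrite mdeg_eq0 => /eqP -> _.
  by rewrite !big1 => [|i _|i _|i _]; rewrite ?mnm0E ?expr0 //; ring.
have /mdeg1P[i /eqP ->] : mdeg m == 1%N by rewrite eqn_leq m1.
have prodU (v : 'I_n -> R) : \prod_(j < n) v j ^+ fun_of_multinom (mnm1 i) j = v i.
  rewrite (bigD1 i) //= big1 => [|j ji]; rewrite mnm1E ?eqxx ?expr1 ?mulr1 //.
  by rewrite eq_sym (negPf ji).
by rewrite !prodU !mxE.
Qed.

Lemma affine_is_mpoly (R : realType) (n : nat) (c0 : R) (c : 'cV[R]_n) :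
  exists2 P : mpoly n R, (msize P <= 2)%N &
    forall x, mpoly_fun P x = c0 + (x *m c) ord0 ord0.
Proof.
exists (mpolyC n c0 + \sum_(i < n) c i ord0 *: mpolyX R (mnm1 i)).
  apply: (leq_trans (msizeD_le _ _)); rewrite geq_max msizeC.
  apply/andP; split; first by case: (c0 != 0).
  elim/big_ind: _ => [|p q hp hq|i _]; first by rewrite msize0.
    by apply: (leq_trans (msizeD_le _ _)); rewrite geq_max hp.
  by apply: (leq_trans (msizeZ_le _ _)); rewrite msizeX mdeg1.
move=> x; rewrite /mpoly_fun mevalD mevalC raddf_sum mxE; congr (_ + _).
by apply: eq_bigr => i _; rewrite /= mevalZ mevalXU mulrC.
Qed.

(** * The two bounds *)

Lemma finite_diff2E (R : realType) (n : nat) (f : 'rV[R]_n -> R) (x h : 'rV[R]_n) :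
  finite_diff 2 h f x = f x - 2 * f (x + h) + f (x + 2 *: h).
Proof.
rewrite /finite_diff !big_ord_recr big_ord0 /= !bin0 bin1 binn.
by rewrite scale0r scale1r addr0; ring.
Qed.

Lemma whitney_convex2_le (R : realType) (n : nat) (K : set 'rV[R]_n)
    (hK : convex_body K) (hsym : K = -%R @` K) :
  (whitney_convex 2 K <= (2^-1)%:E)%E.
Proof.
have [Kcpt Kcvx Kint] := hK.
have small := symmetric_convex_small _ _ K Kcvx Kint hsym.
have KN x : K x -> K (- x) by move=> Kx; rewrite hsym; exists x.
have Kne : K !=set0 by have [x /interior_subset Kx] := Kint; exists x.
apply/ereal_supP => _ [f [[fcont fmid] fmod] <-].
have [z _ fz] := compact_EVT_max Kne Kcpt fcont.
have fconv : forall x y t, K x -> K y -> 0 <= t <= 1 ->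
    f (t *: x + (1 - t) *: y) <= t * f x + (1 - t) * f y.
  move=> x y t; apply: (midpoint_convex_bounded_convex R _ K Kcvx f (f z)) => //.
  by move=> u Ku; apply: fz; exact: mem_set.
have [c hc] := subgradient_exists R n K Kcvx f fconv small.
(* The graph of f lies between f 0 + l and f 0 + l + 1, so the best constant is
   half-way. *)
have [P degP PE] := affine_is_mpoly R n (f 0 + 2^-1) c.
apply: (@le_trans _ _ (sup_norm_on K (fun x => f x - mpoly_fun P x))).
  by apply: ereal_inf_lbound; exists P.
apply/ereal_supP => _ [x Kx <-]; rewrite lee_fin PE.
have lN : ((- x) *m c) ord0 ord0 = - (x *m c) ord0 ord0 by rewrite mulNmx mxE.
have x2 : - x + 2 *: x = x by rewrite scaler_nat mulr2n addKr.
(* The base point - x puts the middle node at 0, where l touches f - f 0. *)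
have : `|finite_diff 2 x f (- x)| <= 1.
  rewrite -lee_fin; apply: le_trans fmod; apply: ereal_sup_ubound.
  exists (- x, x) => //= -[|[|[|//]]] _; rewrite ?scale0r ?scale1r ?addr0.
  - exact: KN.
  - by rewrite addNr; have [d _] := small 0; rewrite scaler0.
  - by rewrite x2.
rewrite finite_diff2E addNr x2 ler_norml => /andP[_ hd].
have := hc _ Kx; have := hc _ (KN _ Kx); rewrite lN ler_norml => h1 h2.
by apply/andP; split; lra.
Qed.

Lemma whitney_convex2_ge (R : realType) (n : nat) (hn : (0 < n)%N)
    (K : set 'rV[R]_n) (hK : convex_body K) (hsym : K = -%R @` K) :
  ((2^-1)%:E <= whitney_convex 2 K)%E.
Proof.
have [Kcpt Kcvx Kint] := hK.
have small := symmetric_convex_small _ _ K Kcvx Kint hsym.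
have KN x : K x -> K (- x) by move=> Kx; rewrite hsym; exists x.
have Kne : K !=set0 by have [x /interior_subset Kx] := Kint; exists x.
pose i := Ordinal hn.
have ccont : continuous (fun x : 'rV[R]_n => x ord0 i) by exact: coord_continuous.
have [v /set_mem Kv vmax] := compact_EVT_max Kne Kcpt (continuous_subspaceT ccont).
set M := v ord0 i in vmax.
have M0 : 0 < M.
  have [d d0 Kd] := small (delta_mx ord0 i).
  by have := vmax _ (mem_set Kd); rewrite !mxE !eqxx mulr1; apply: lt_le_trans.
have xM x : K x -> x ord0 i / M <= 1.
  by move=> Kx; rewrite ler_pdivrMr // mul1r; exact/vmax/mem_set.
apply/lee_addgt0Pr => r r0.
(* The width e of the cap controls the loss e / 4, which has to be below r. *)
pose e := Num.min r 2^-1.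
have e0 : 0 < e by rewrite lt_min r0 invr_gt0 ltr0n.
have er : e <= r by rewrite ge_min lexx.
have e1 : e <= 2^-1 by rewrite ge_min lexx orbT.
pose u (x : 'rV[R]_n) := (x ord0 i / M - (1 - e)) / e.
pose f x := Num.max 0 (u x).
have f0 x : 0 <= f x by rewrite le_max lexx.
have fu x : u x <= f x by rewrite le_max lexx orbT.
have fle x b : 0 <= b -> u x <= b -> f x <= b by move=> ? ?; rewrite ge_max; apply/andP.
have f1 x : K x -> f x <= 1.
  by move=> /xM xM1; apply: fle => //; rewrite ler_pdivrMr // mul1r; lra.
have gcont : continuous (fun r : R => (r / M - (1 - e)) / e).
  move=> b; apply: cvgMr_tmp; apply: cvgB; last exact: cvg_cst.
  by apply: cvgMr_tmp; exact: cvg_id.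
have ucont : continuous u.
  by move=> x; exact: (continuous_comp (ccont x) (gcont _)).
have fcont : continuous f.
  move=> x; apply: (@continuous_max _ _ (fun=> 0) u x); last exact: ucont.
  exact: (@cst_continuous _ R^o).
have fmono (x y : 'rV[R]_n) : x ord0 i <= y ord0 i -> f x <= f y.
  move=> xy; apply: fle => //; apply: le_trans (fu y).
  by rewrite ler_pM2r ?invr_gt0 // lerD2r ler_pM2r ?invr_gt0.
have fmid (x y : 'rV[R]_n) : 2 * f (2^-1 *: (x + y)) <= f x + f y.
  rewrite -ler_pdivlMl //; apply: fle; first by rewrite mulr_ge0 ?addr_ge0.
  have -> : u (2^-1 *: (x + y)) = 2^-1 * (u x + u y).
    by rewrite /u !mxE; field; rewrite !gt_eqF.
  by have := fu x; have := fu y; lra.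
apply: (@le_trans _ _ (best_approx 1 f K + r%:E)%E); last first.
  apply: leeD => //; apply: ereal_sup_ubound; exists f => //; split.
    by split=> [|x y _ _]; [exact: continuous_subspaceT | exact: fmid].
  apply/ereal_supP => _ [[x h] /= Kxh <-]; rewrite lee_fin finite_diff2E.
  have := Kxh 0%N isT; have := Kxh 1%N isT; have := Kxh 2%N isT.
  rewrite scale0r addr0 scale1r => K2 K1 K0.
  have := fmid x (x + 2 *: h).
  have -> : 2^-1 *: (x + (x + 2 *: h)) = x + h.
    have -> : x + (x + 2 *: h) = 2 *: (x + h).
      by rewrite scalerDr [2 *: x]scaler_nat [x *+ 2]mulr2n addrA.
    by rewrite scalerA mulVf ?scale1r // pnatr_eq0.
  have := f1 _ K2; have := f1 _ K0; have := f0 (x + h).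
  rewrite ler_norml => a b c d; apply/andP; split; first by lra.
  (* f does not decrease from one of the end nodes to the middle one, so that
     end value cancels against one copy of the middle value. *)
  have [h0|h0] := leP 0 (h ord0 i).
    have : f x <= f (x + h) by apply: fmono; rewrite mxE lerDl.
    by lra.
  have : f (x + 2 *: h) <= f (x + h).
    by apply: fmono; rewrite !mxE; lra.
  by lra.
rewrite -leeBlDr //; apply/ereal_infP => _ [P degP <-].
pose s := sup_norm_on K (fun x => f x - mpoly_fun P x).
have sP x : K x -> (`|f x - mpoly_fun P x|%:E <= s)%E.
  by move=> Kx; apply: ereal_sup_ubound; exists x.
(* w below is (1 - e) *: v, the inner edge of the cap on the segment from - v
   to v, written as a combination of the end points. *)
pose t := 1 - e / 2.
have t01 : 0 <= t <= 1 by rewrite /t; lra.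
pose w := t *: v + (1 - t) *: - v.
have Kw : K w by apply: convex_set_comb => //; exact: KN.
have fv : f v = 1.
  apply/eqP; rewrite eq_le f1 //=; apply: le_trans (fu v).
  by rewrite /u divff ?gt_eqF // ler_pdivlMr //; lra.
have fw : f w = 0.
  apply/eqP; rewrite eq_le f0 andbT; apply: fle => //.
  rewrite (_ : u w = 0) // /u !mxE -/M /t; field.
  by rewrite !gt_eqF.
have fNv : f (- v) = 0.
  apply/eqP; rewrite eq_le f0 andbT -fw; apply: fmono.
  by rewrite !mxE -/M /t; nra.
have := sP _ Kv; have := sP _ (KN _ Kv); have := sP _ Kw; rewrite -/s.
rewrite mpoly_fun_affine // fv fw fNv.
case: {sP} s => [s| |]; [|by move=> *; rewrite leey|by rewrite leeNy_eq].
rewrite !lee_fin !ler_norml => /andP[a1 a2] /andP[b1 b2] /andP[c1 c2].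
set p := mpoly_fun P v in a1 a2 c1 c2; set q := mpoly_fun P (- v) in a1 a2 b1 b2.
have : t * (1 - s) - (1 - t) * s <= t * p + (1 - t) * q by nra.
have tE : t = 1 - e / 2 by [].
by lra.
Qed.

Theorem theorem1p3 (R : realType) (n : nat) (hn : (0 < n)%N)
    (K : set 'rV[R]_n) (hK : convex_body K) (hsym : K = -%R @` K) :
  whitney_convex 2 K = (2^-1)%:E.
Proof.
apply/eqP; rewrite eq_le whitney_convex2_le //=.
exact: whitney_convex2_ge.
Qed.
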